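(* Let $(G,\sigma)$ be a connection graph with $d$-dimensional signature $\sigma$, let $1\le\rho\le d$ be the dimension of the kernel of $\mathcal{L}^\sigma$, and let $\tau$ be the absolutely inconsistent component of $\sigma$, i.e. a $(d-\rho)$-dimensional signature with $\mathcal{L}^\tau$ invertible and $\sigma\cong(\bigoplus_{l=1}^{\rho}\iota^1)\oplus\tau$. Then for distinct $i,j\in V$, $$r^\sigma_{ij}=\frac{\rho}{d}\,r_{ij}+\frac{1}{2d}\operatorname{Tr}\Big((\mathcal{C}^\tau_{ii})^{-1}+(\mathcal{C}^\tau_{jj})^{-1}\Big).$$
   Context: $G=(V,E,W)$ finite connected weighted graph, $V=\{1,\dots,n\}$, $w_{xy}>0$ iff $\{x,y\}\in E$, $\deg(x)=\sum_yw_{xy}$. A $d$-dimensional signature maps oriented edges to $\mathsf{O}(d)$ with $\sigma_{yx}=\sigma_{xy}^{\mathrm T}$. Connection Laplacian $\mathcal{L}^\sigma$: $nd\times nd$ block matrix with blocks $\deg(x)I_d$ on the diagonal, $-w_{xy}\sigma_{xy}$ for $x\sim y$, $0$ otherwise. $\sigma\cong\tau'$ means there is $f:V\to\mathsf{O}(d)$ with $f(x)\sigma_{xy}=\tau'_{xy}f(y)$; $\oplus$ is edgewise block-diagonal sum; $\iota^1$ is the $1$-dimensional signature identically $1$. For $M=\begin{bmatrix}A&B\\C&D\end{bmatrix}$, $M/D=A-BD^\dagger C$; conductance matrix $\mathcal{C}^\tau(i,j)=\mathcal{L}^\tau/\mathcal{L}^\tau_{\{i,j\}^c,\{i,j\}^c}$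 with diagonal blocks $\mathcal{C}^\tau_{ii},\mathcal{C}^\tau_{jj}$. $r_{ij}=(e_i-e_j)^{\mathrm T}L^\dagger(e_i-e_j)$ with $L=D-W$ the graph Laplacian. $\Omega^0_{ij}=\mathbb{E}[\prod_{\ell=1}^{T^0_j}\sigma_{X_{\ell-1}X_\ell}\mid X_0=i]$ for the simple random walk with transition probabilities $w_{xy}/\deg(x)$, $T^0_j=\inf\{t\ge0:X_t=j\}$. $N_{ij}$: $nd\times d$ block column with $I_d$ at node $i$, $-(\Omega^0_{ij})^{\mathrm T}$ at node $j$, $0$ elsewhere; $\mathcal{W}_{i\to j}=(\mathcal{L}^\sigma)^\dagger N_{ij}$. Connection effective resistance: $r^\sigma_{ij}=\frac{1}{2d}\operatorname{Tr}\big(\mathcal{W}_{i\to j}^{\mathrm T}\mathcal{L}^\sigma\mathcal{W}_{i\to j}+\mathcal{W}_{j\to i}^{\mathrm T}\mathcal{L}^\sigma\mathcal{W}_{j\to i}\big)$. (If $\rho=d$, $\tau$ is $0$-dimensional and its trace term is $0$.) *)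

(* Defs.v *)
From HB Require Import structures.
From mathcomp Require Import all_boot all_order all_algebra.
From mathcomp Require Import boolp classical_sets filter topology normedtype sequences reals.
Set Implicit Arguments. Unset Strict Implicit. Unset Printing Implicit Defensive.
Import Order.TTheory GRing.Theory Num.Theory numFieldNormedType.Exports.
Local Open Scope ring_scope.

Section ConnectionGraphs.
Variable R : realType.

Definition penrose m n (A : 'M[R]_(m, n)) (X : 'M[R]_(n, m)) : Prop :=
  [/\ A *m X *m A = A, X *m A *m X = X, (A *m X)^T = A *m X & (X *m A)^T = X *m A].

Definition pinv m n (A : 'M[R]_(m, n)) : 'M[R]_(n, m) := xget 0 [set X | penrose A X].

Definition adj n (W : 'M[R]_n) : rel 'I_n := fun x y => 0 < W x y.

Definition weighted_graph n (W : 'M[R]_n) : Prop :=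
  [/\ W^T = W, (forall x y, 0 <= W x y) & (forall x, W x x = 0)].

Definition connected_graph n (W : 'M[R]_n) : Prop :=
  forall x y : 'I_n, connect (adj W) x y.

Definition degw n (W : 'M[R]_n) (x : 'I_n) : R := \sum_(y < n) W x y.

Definition orthogonal_mx d (A : 'M[R]_d) : Prop := A *m A^T = 1%:M.

Definition signature n d (W : 'M[R]_n) (s : 'I_n -> 'I_n -> 'M[R]_d) : Prop :=
  forall x y, adj W x y -> orthogonal_mx (s x y) /\ s y x = (s x y)^T.

(* ---- flat indexing of R^{n d}: node x, component a  <->  index mxvec_index x a ---- *)
Definition unflat n d (p : 'I_(n * d)) : 'I_n * 'I_d :=
  enum_val (cast_ord (esym (mxvec_cast n d)) p).
Definition node n d (p : 'I_(n * d)) : 'I_n := (unflat p).1.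
Definition comp n d (p : 'I_(n * d)) : 'I_d := (unflat p).2.
Definition flat n d (x : 'I_n) (a : 'I_d) : 'I_(n * d) := mxvec_index x a.

(* connection Laplacian: blocks deg(x) I_d on the diagonal, -w_xy sigma_xy off it
   (w_xy = 0 off edges, and there are no loops) *)
Definition conn_lap n d (W : 'M[R]_n) (s : 'I_n -> 'I_n -> 'M[R]_d) : 'M[R]_(n * d) :=
  \matrix_(p, q)
    if node p == node q then degw W (node p) * (comp p == comp q)%:R
    else - W (node p) (node q) * s (node p) (node q) (comp p) (comp q).

Definition graph_lap n (W : 'M[R]_n) : 'M[R]_n :=
  \matrix_(x, y) ((x == y)%:R * degw W x - W x y).

Definition evec n (i : 'I_n) : 'cV[R]_n := \col_x (x == i)%:R.

Definition eff_res n (W : 'M[R]_n) (i j : 'I_n) : R :=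
  ((evec i - evec j)^T *m pinv (graph_lap W) *m (evec i - evec j)) 0 0.

(* ---- Omega^0_ij = E[ prod_{l=1}^{T_j} sigma_{X_{l-1} X_l} | X_0 = i ] ----
   paths of length t are p : {ffun 'I_t.+1 -> 'I_n}; the walk stopped at its
   first visit to j contributes P(path) * (ordered product of sigma's). *)
Definition step_from t (s : 'I_t) : 'I_t.+1 := widen_ord (leqnSn t) s.
Definition step_to t (s : 'I_t) : 'I_t.+1 := lift ord0 s.

Definition first_passage_path n t (i j : 'I_n) (p : {ffun 'I_t.+1 -> 'I_n}) : bool :=
  [&& p ord0 == i, p ord_max == j & [forall s : 'I_t, p (step_from s) != j]].

Definition path_prob n t (W : 'M[R]_n) (p : {ffun 'I_t.+1 -> 'I_n}) : R :=
  \prod_(s < t) (W (p (step_from s)) (p (step_to s)) / degw W (p (step_from s))).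

Definition path_hol n d t (s : 'I_n -> 'I_n -> 'M[R]_d) (p : {ffun 'I_t.+1 -> 'I_n}) : 'M[R]_d :=
  \big[mulmx/1%:M]_(l < t) s (p (step_from l)) (p (step_to l)).

Definition omega_term n d (W : 'M[R]_n) (s : 'I_n -> 'I_n -> 'M[R]_d) (i j : 'I_n) t : 'M[R]_d :=
  \sum_(p : {ffun 'I_t.+1 -> 'I_n} | first_passage_path i j p) path_prob W p *: path_hol s p.

Definition omega0 n d (W : 'M[R]_n) (s : 'I_n -> 'I_n -> 'M[R]_d) (i j : 'I_n) : 'M[R]_d :=
  \matrix_(a, b) limn (fun N => \sum_(t < N) omega_term W s i j t a b).

Definition Nmx n d (W : 'M[R]_n) (s : 'I_n -> 'I_n -> 'M[R]_d) (i j : 'I_n) : 'M[R]_(n * d, d) :=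
  \matrix_(p, b)
    if node p == i then (comp p == b)%:R
    else if node p == j then - (omega0 W s i j)^T (comp p) b else 0.

Definition Wflow n d (W : 'M[R]_n) (s : 'I_n -> 'I_n -> 'M[R]_d) (i j : 'I_n) : 'M[R]_(n * d, d) :=
  pinv (conn_lap W s) *m Nmx W s i j.

Definition conn_res n d (W : 'M[R]_n) (s : 'I_n -> 'I_n -> 'M[R]_d) (i j : 'I_n) : R :=
  (2 * d)%:R^-1 *
  \tr ((Wflow W s i j)^T *m conn_lap W s *m Wflow W s i j
       + (Wflow W s j i)^T *m conn_lap W s *m Wflow W s j i).

(* ---- conductance matrix C(i,j) = L / L_{{i,j}^c,{i,j}^c}; its diagonal block at x in {i,j}:
   L_{xx} - L_{x,Ac} (L_{Ac,Ac})^+ L_{Ac,x}, with Ac = indices of nodes outside {i,j}. ---- *)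
Definition outside n d (i j : 'I_n) : pred 'I_(n * d) :=
  fun p => (node p != i) && (node p != j).

Definition cond_block n d (L : 'M[R]_(n * d)) (i j x : 'I_n) : 'M[R]_d :=
  let ac := @enum_val _ (@outside n d i j) in
  mxsub (flat x) (flat x) L
  - mxsub (flat x) ac L *m pinv (mxsub ac ac L) *m mxsub ac (flat x) L.

End ConnectionGraphs.

(* Main.v *)
(** Gauging by [f] reduces the problem to the direct sum of the trivial and the
    [tau] connections.  The matrices [Omega^0_{xj}] form the unique function equal
    to [1] at [j] and harmonic off [j]; uniqueness holds because the energy
    [1/2 sum w_xy |u_x - sigma_xy u_y|^2] vanishes only on parallel functions.  Hence
    [Omega^0] splits as well, and one obtains an explicit potential [V] with
    [L V = N_ij], so that the energy of the flow is [tr (V^T N_ij)].  The trivial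
    summand contributes [rho] copies of [r_ij].  On the [tau] summand,
    [u_x = V_x - Omega^0_xj V_j] vanishes at [j] and satisfies [L u = 1] at [i] and
    [L u = 0] at the other nodes, so eliminating the nodes outside [{i,j}] gives
    [C_ii u_i = 1], while [tr u_i] is exactly the [tau] part of the energy. *)
Require Import Defs.
From HB Require Import structures.
From mathcomp Require Import all_boot all_order all_algebra ring.
From mathcomp Require Import boolp classical_sets filter topology normedtype sequences reals.
Import Order.TTheory GRing.Theory Num.Theory numFieldNormedType.Exports.
Local Open Scope ring_scope.
Set Implicit Arguments. Unset Strict Implicit. Unset Printing Implicit Defensive.

(** * First-passage walks and convergence of the series defining [omega0] *)

Section FirstPassage.
Variables (R : realType) (n : nat) (W : 'M[R]_n).

Let path_cons t (i : 'I_n) (q : {ffun 'I_t.+1 -> 'I_n}) : {ffun 'I_t.+2 -> 'I_n} :=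
  [ffun l => if unlift ord0 l is Some l' then q l' else i].
Let path_tail t (p : {ffun 'I_t.+2 -> 'I_n}) : {ffun 'I_t.+1 -> 'I_n} :=
  [ffun l => p (lift ord0 l)].

Let path_cons0 t i (q : {ffun 'I_t.+1 -> 'I_n}) : path_cons i q ord0 = i.
Proof. by rewrite ffunE unlift_none. Qed.

Let path_consS t i (q : {ffun 'I_t.+1 -> 'I_n}) l : path_cons i q (lift ord0 l) = q l.
Proof. by rewrite ffunE liftK. Qed.

Let path_consK t i : cancel (@path_cons t i) (@path_tail t).
Proof. by move=> q; apply/ffunP=> l; rewrite ffunE path_consS. Qed.

Let path_tailK t i (p : {ffun 'I_t.+2 -> 'I_n}) :
  p ord0 = i -> path_cons i (path_tail p) = p.
Proof.
move=> p0; apply/ffunP=> l; rewrite ffunE.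
by case: unliftP => [l' ->|->]; rewrite ?ffunE ?p0.
Qed.

Let step_from0 t : step_from (ord0 : 'I_t.+1) = ord0.
Proof. exact: val_inj. Qed.

Let step_fromS t (l : 'I_t) : step_from (lift ord0 l) = lift ord0 (step_from l).
Proof. exact: val_inj. Qed.

Lemma omega_term0 d (s : 'I_n -> 'I_n -> 'M[R]_d) i j :
  omega_term W s i j 0 = (i == j)%:R%:M.
Proof.
rewrite /omega_term; have [<-|ij] := eqVneq i j.
  rewrite (big_pred1 [ffun=> i]).
    by rewrite /path_prob /path_hol !big_ord0 scale1r.
  move=> p /=; rewrite /first_passage_path; apply/and3P/eqP => [[/eqP p0 _ _]|->].
    by apply/ffunP=> l; rewrite (ord1 l) ffunE.
  by rewrite !ffunE !eqxx; split=> //; apply/forallP=> -[].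
rewrite big_pred0 ?raddf0 //= => p.
apply/negP => /and3P[/eqP p0 /eqP pm _]; case/negP: ij.
by rewrite -p0 -pm (_ : ord_max = ord0) //; apply: val_inj.
Qed.

(** First-step analysis: away from [j], a first-passage path is [i] followed by a first-passage path
    one step shorter. From [j] itself the walk has already stopped at time 0. *)
Lemma omega_termS d (s : 'I_n -> 'I_n -> 'M[R]_d) i j t :
  omega_term W s i j t.+1 =
  if i == j then 0
  else \sum_y (W i y / degw W i) *: (s i y *m omega_term W s y j t).
Proof.
rewrite /omega_term; case: ifPn => [/eqP <-|ij].
  rewrite big_pred0 // => p; apply/negP => /and3P[p0 _ /forallP /(_ ord0)].
  by rewrite step_from0 p0.
(* The sum now runs over tails [q]; prepending [i] recovers the path. *)
rewrite (reindex_onto (path_cons i) (@path_tail t)) /=; last first.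
  by move=> p /and3P[/eqP p0 _ _]; apply: path_tailK.
under eq_bigl => q.
  rewrite path_consK eqxx andbT.
  have -> : first_passage_path i j (path_cons i q) = first_passage_path (q ord0) j q.
    rewrite /first_passage_path path_cons0 !eqxx /=.
    have -> : ord_max = lift ord0 (ord_max : 'I_t.+1) by apply: val_inj.
    rewrite path_consS; congr (_ && _); apply/forallP/forallP => H l.
      by have := H (lift ord0 l); rewrite step_fromS path_consS.
    case: (unliftP ord0 l) => [l' ->|->]; first by rewrite step_fromS path_consS.
    by rewrite step_from0 path_cons0.
  over.
(* Tails are grouped by their first node [y], the one reached after one step. *)
rewrite (partition_big (fun q : {ffun 'I_t.+1 -> 'I_n} => q ord0) predT) //=.
apply: eq_bigr => y _; rewrite mulmx_sumr scaler_sumr.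
apply: eq_big => [q|q /andP[_ /eqP q0]].
  by rewrite /first_passage_path; case: (q ord0 =P y) => [->|_]; rewrite ?eqxx ?andbT ?andbF.
rewrite /path_prob /path_hol !big_ord_recl step_from0 path_cons0 path_consS q0.
under eq_bigr do rewrite step_fromS !path_consS.
rewrite -scalerA -scalemxAr; congr (_ *: (_ *: (_ *m _))).
by apply: eq_bigr => l _; rewrite step_fromS !path_consS.
Qed.

Lemma path_hol_orthogonal d (s : 'I_n -> 'I_n -> 'M[R]_d) t (p : {ffun 'I_t.+1 -> 'I_n}) :
  (forall l : 'I_t, orthogonal_mx (s (p (step_from l)) (p (step_to l)))) ->
  orthogonal_mx (path_hol s p).
Proof.
move=> so; rewrite /path_hol; elim/big_ind: _ => //.
- by rewrite /orthogonal_mx mul1mx trmx1.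
- move=> A B AA BB; rewrite /orthogonal_mx trmx_mul mulmxA -(mulmxA A).
  by rewrite [B *m _]BB mulmx1.
Qed.

(** Row [a] of an orthogonal matrix has Euclidean norm 1. *)
Lemma orthogonal_entry_le1 d (A : 'M[R]_d) a b : orthogonal_mx A -> `|A a b| <= 1.
Proof.
move=> /matrixP/(_ a a); rewrite !mxE eqxx => AA.
rewrite -[_ <= 1]ler_sqr ?nnegrE // real_normK ?num_real // expr1n -[leRHS]AA.
rewrite (bigD1 b) //= mxE expr2 lerDl; apply: sumr_ge0 => c _.
by rewrite mxE -expr2 sqr_ge0.
Qed.

Hypothesis Wg : weighted_graph W.

Lemma weight_ge0 x y : 0 <= W x y. Proof. by case: Wg => _ /(_ x y). Qed.

Lemma weight_sym x y : W x y = W y x. Proof. by case: Wg => /matrixP/(_ y x); rewrite mxE. Qed.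

Lemma degw_ge0 x : 0 <= degw W x. Proof. by apply: sumr_ge0 => y _; exact: weight_ge0. Qed.

Lemma path_prob_ge0 t (p : {ffun 'I_t.+1 -> 'I_n}) : 0 <= path_prob W p.
Proof. by apply: prodr_ge0 => l _; rewrite divr_ge0 ?weight_ge0 ?degw_ge0. Qed.

(* The trivial 1-dimensional signature turns [omega_term] into the probability
   that the first passage at [j] happens at time [t]. *)
Definition passage_prob (i j : 'I_n) t : R :=
  omega_term W (fun _ _ => 1%:M : 'M[R]_1) i j t 0 0.

Lemma passage_probE i j t :
  passage_prob i j t = \sum_(p : {ffun 'I_t.+1 -> 'I_n} | first_passage_path i j p) path_prob W p.
Proof.
rewrite /passage_prob /omega_term summxE; apply: eq_bigr => p _.
rewrite /path_hol (_ : \big[_/_]_(_ < _) _ = 1%:M) ?mxE ?eqxx ?mulr1 //.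
by elim/big_rec: _ => // l A _ ->; rewrite mulmx1.
Qed.

Lemma passage_prob_ge0 i j t : 0 <= passage_prob i j t.
Proof. by rewrite passage_probE; apply: sumr_ge0 => p _; exact: path_prob_ge0. Qed.

(** Induction on the horizon [N] through the first step; this bound is what makes the series for
    [omega0] converge. *)
Lemma sum_passage_prob_le1 i j N : \sum_(t < N) passage_prob i j t <= 1.
Proof.
elim: N i => [|N IHN] i; first by rewrite big_ord0 ler01.
rewrite big_ord_recl {1}/passage_prob omega_term0 !mxE eqxx mulr1n.
under eq_bigr => t _ do rewrite /passage_prob omega_termS.
case: (i == j).
  by rewrite big1 ?addr0 // => t _; rewrite mxE.
rewrite mulr0n add0r.
have -> : \sum_(t < N) (\sum_y (W i y / degw W i) *:
    (1%:M *m omega_term W (fun _ _ => 1%:M : 'M[R]_1) y j t)) 0 0 =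
  \sum_y (W i y / degw W i) * \sum_(t < N) passage_prob y j t.
  under eq_bigr => t _ do rewrite summxE.
  rewrite exchange_big; apply: eq_bigr => y _; rewrite mulr_sumr.
  by apply: eq_bigr => t _; rewrite mul1mx mxE.
apply: (@le_trans _ _ (\sum_y W i y / degw W i)).
  apply: ler_sum => y _; rewrite ler_piMr // divr_ge0 ?weight_ge0 //.
  exact: degw_ge0.
(* The transition probabilities out of [i] sum to 1, or to 0 when the degree is 0, since division by
   0 gives 0. *)
rewrite -mulr_suml -/(degw W i); have [->|d0] := eqVneq (degw W i) 0.
  by rewrite mul0r ler01.
by rewrite divff.
Qed.

Section Signature.
Variables (d : nat) (s : 'I_n -> 'I_n -> 'M[R]_d).
Hypothesis sig : signature W s.

(** A path of nonzero probability follows edges only, so its holonomy is orthogonal and has entries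
    at most 1 in absolute value. *)
Lemma omega_term_le i j t a b : `|omega_term W s i j t a b| <= passage_prob i j t.
Proof.
rewrite passage_probE /omega_term summxE; apply: le_trans (ler_norm_sum _ _ _) _.
apply: ler_sum => p _; rewrite mxE normrM ger0_norm ?path_prob_ge0 //.
have [->|p0] := eqVneq (path_prob W p) 0; first by rewrite mul0r.
rewrite ler_piMr ?path_prob_ge0 //; apply/orthogonal_entry_le1/path_hol_orthogonal => l.
suff /sig[] : adj W (p (step_from l)) (p (step_to l)) by [].
rewrite /adj lt_neqAle weight_ge0 andbT eq_sym; apply: contraNneq p0 => w0.
by rewrite /path_prob (bigD1 l) //= w0 !mul0r.
Qed.

(** Absolute convergence by comparison with the passage probabilities; it ensures that the [limn] in
    [omega0] is a genuine limit. *)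
Lemma cvg_omega0 i j a b :
  (\sum_(t < N) omega_term W s i j t a b @[N --> \oo] --> omega0 W s i j a b)%classic.
Proof.
rewrite /omega0 mxE.
have -> : (fun N => \sum_(t < N) omega_term W s i j t a b) =
    series (fun t => omega_term W s i j t a b).
  by apply/funext => N; rewrite /series /= big_mkord.
apply: normed_cvg.
apply: (@series_le_cvg _ _ (passage_prob i j)) => [t|t|t|].
- exact: normr_ge0.
- exact: passage_prob_ge0.
- exact: omega_term_le.
apply: nondecreasing_is_cvgn => [m m' mm'|].
  rewrite -subr_ge0 sub_series_geq //.
  by apply: sumr_ge0 => t _; exact: passage_prob_ge0.
exists 1 => _ [N _ <-]; rewrite /series /= big_mkord; exact: sum_passage_prob_le1.
Qed.

Lemma omega0_id j : omega0 W s j j = 1%:M.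
Proof.
apply/matrixP=> a b.
rewrite [LHS]mxE; apply: cvg_lim; first exact: norm_hausdorff.
rewrite -cvg_shiftS (_ : (fun _ => _) = (fun=> 1%:M a b)); first exact: cvg_cst.
apply/funext => N /=; rewrite big_ord_recl omega_term0 eqxx big1 ?addr0 // => t _.
by rewrite omega_termS eqxx mxE.
Qed.

(** The first-step recursion summed over time: the partial sum of length [N.+1] at [i] averages
    those of length [N] at the next nodes, and the limit commutes with the finite sums. *)
Lemma omega0_step (i j : 'I_n) : i != j ->
  omega0 W s i j = \sum_y (W i y / degw W i) *: (s i y *m omega0 W s y j).
Proof.
move=> ij; apply/matrixP=> a b; rewrite summxE [LHS]mxE.
apply: cvg_lim; first exact: norm_hausdorff.
rewrite -cvg_shiftS.
have -> : [sequence \sum_(t < N.+1) omega_term W s i j t a b]_N =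
   (fun N => \sum_y W i y / degw W i * \sum_c (s i y a c * \sum_(t < N) omega_term W s y j t c b)).
  apply/funext => N /=; rewrite big_ord_recl omega_term0 (negbTE ij) mulr0n raddf0 [X in X + _]mxE add0r.
  transitivity (\sum_(t < N) \sum_y ((W i y / degw W i) *: (s i y *m omega_term W s y j t)) a b).
    by apply: eq_bigr => t _; rewrite -summxE (omega_termS s i j t) (negbTE ij).
  rewrite exchange_big; apply: eq_bigr => y _.
  under eq_bigr => t _ do rewrite !mxE.
  rewrite -mulr_sumr exchange_big; congr (_ * _).
  by apply: eq_bigr => c _; rewrite mulr_sumr.
apply: cvg_big => [|y _]; first exact: add_continuous.
rewrite !mxE; apply: cvgMl_tmp.
apply: cvg_big => [|c _]; first exact: add_continuous.
by apply: cvgMl_tmp; exact: cvg_omega0.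
Qed.

End Signature.
End FirstPassage.

(** * Moore-Penrose inverses of real matrices *)

Section PseudoInverse.
Variable R : realType.

Lemma tr_mul_entry m n (A : 'M[R]_(m, n)) b : (A^T *m A) b b = \sum_a A a b ^+ 2.
Proof. by rewrite mxE; apply: eq_bigr => a _; rewrite mxE expr2. Qed.

Lemma tr_mul_eq0 m n (A : 'M[R]_(m, n)) : A^T *m A = 0 -> A = 0.
Proof.
move=> AA0; apply/matrixP=> a b; rewrite mxE.
have /eqP := tr_mul_entry A b; rewrite AA0 mxE eq_sym psumr_eq0; last first.
  by move=> c _; exact: sqr_ge0.
by move=> /allP/(_ a); rewrite mem_index_enum sqrf_eq0 => /(_ isT)/eqP.
Qed.

Lemma gram_unit m n (A : 'M[R]_(m, n)) : row_free A -> A *m A^T \in unitmx.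
Proof.
move=> Afree; rewrite -row_free_unit; apply: inj_row_free => v vAA.
apply/eqP; rewrite -(mulmx_free_eq0 _ Afree); apply/eqP.
have : (v *m A)^T = 0.
  by apply: tr_mul_eq0; rewrite trmxK trmx_mul -mulmxA [A *m _]mulmxA mulmxA vAA mul0mx.
by move/(congr1 trmx); rewrite trmxK trmx0.
Qed.

(** The full-rank factorization formula: the product of the right inverse of [B] and the left
    inverse of [C] built from their Gram matrices. *)
Lemma penrose_factor m r n (C : 'M[R]_(m, r)) (B : 'M[R]_(r, n)) :
  C^T *m C \in unitmx -> B *m B^T \in unitmx ->
  penrose (C *m B) (B^T *m invmx (B *m B^T) *m (invmx (C^T *m C) *m C^T)).
Proof.
move=> uC uB; set X := _ *m (_ *m C^T).
have AX : C *m B *m X = C *m invmx (C^T *m C) *m C^T.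
  by rewrite /X -!mulmxA [B *m (B^T *m _)]mulmxA (mulKVmx uB).
have XA : X *m (C *m B) = B^T *m invmx (B *m B^T) *m B.
  by rewrite /X -!mulmxA [C^T *m (C *m _)]mulmxA (mulKmx uC).
split.
- by rewrite AX -!mulmxA [C^T *m (C *m _)]mulmxA (mulKmx uC).
- by rewrite XA /X -!mulmxA [B *m (B^T *m _)]mulmxA (mulKVmx uB).
- by rewrite AX !trmx_mul trmxK trmx_inv trmx_mul trmxK mulmxA.
- by rewrite XA !trmx_mul trmxK trmx_inv trmx_mul trmxK mulmxA.
Qed.

(** Existence, which [xget] requires, comes from the rank factorization
    [col_base A *m row_base A]. *)
Lemma pinvP m n (A : 'M[R]_(m, n)) : penrose A (pinv A).
Proof.
apply: xgetPex.
have uB : row_base A *m (row_base A)^T \in unitmx.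
  by apply: gram_unit; exact: row_base_free.
have uC : (col_base A)^T *m col_base A \in unitmx.
  rewrite -[X in _ *m X]trmxK; apply: gram_unit.
  by rewrite /row_free mxrank_tr; exact: col_base_full.
by have := penrose_factor uC uB; rewrite mulmx_base; eexists; eassumption.
Qed.

Lemma pinv_unit n (A : 'M[R]_n) : A \in unitmx -> pinv A = invmx A.
Proof.
move=> uA; have [AXA _ _ _] := pinvP A.
by rewrite -[pinv A](mulKmx uA) -[A *m pinv A](mulmxK uA) AXA mulmxV // mulmx1.
Qed.

(** By [L X L = L] and its transpose, the energy does not depend on the chosen solution, so any
    explicit potential [V] computes it. *)
Lemma pinv_energy n m (L : 'M[R]_n) (V N : 'M[R]_(n, m)) : L^T = L -> L *m V = N ->
  (pinv L *m N)^T *m L *m (pinv L *m N) = V^T *m N.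
Proof.
move=> Lsym <-; have [LXL _ _ _] := pinvP L.
have LXtL : L *m (pinv L)^T *m L = L.
  by rewrite -[RHS]Lsym -[in RHS]LXL !trmx_mul Lsym mulmxA.
by rewrite !trmx_mul Lsym -!mulmxA [L *m (_^T *m _)]mulmxA [_ *m (L *m _)]mulmxA LXtL
  [L *m (pinv L *m _)]mulmxA [_ *m (L *m _)]mulmxA LXL.
Qed.

End PseudoInverse.

(** * The connection Laplacian acting on node functions: energy and uniqueness *)

Section Laplacian.
Variables (R : realType) (n : nat) (W : 'M[R]_n).

(** The block form of [conn_lap], on [m] columns at once; [conn_lap_stack] links the two. *)
Definition lap d m (s : 'I_n -> 'I_n -> 'M[R]_d) (u : 'I_n -> 'M[R]_(d, m)) x : 'M[R]_(d, m) :=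
  degw W x *: u x - \sum_y W x y *: (s x y *m u y).

Lemma lapB d m (s : 'I_n -> 'I_n -> 'M[R]_d) (u v : 'I_n -> 'M[R]_(d, m)) x :
  lap s (fun y => u y - v y) x = lap s u x - lap s v x.
Proof.
rewrite /lap; under eq_bigr do rewrite mulmxBr scalerBr.
rewrite sumrB scalerBr !opprD !opprK !addrA; congr (_ + _).
by rewrite -!addrA; congr (_ + _); rewrite addrC.
Qed.

Lemma lap_mulmxr d m p (s : 'I_n -> 'I_n -> 'M[R]_d) (u : 'I_n -> 'M[R]_(d, m))
    (A : 'M[R]_(m, p)) x :
  lap s (fun y => u y *m A) x = lap s u x *m A.
Proof.
rewrite /lap mulmxBl -scalemxAl mulmx_suml; congr (_ - _).
by apply: eq_bigr => y _; rewrite mulmxA scalemxAl.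
Qed.

Hypothesis Wg : weighted_graph W.

Lemma degw0_weight0 x y : degw W x = 0 -> W x y = 0.
Proof.
move/eqP; rewrite /degw psumr_eq0 => [/allP/(_ y)|z _]; last exact: weight_ge0.
by rewrite mem_index_enum => /(_ isT)/eqP.
Qed.

Lemma adj_sym x y : adj W x y = adj W y x.
Proof. by rewrite /adj (weight_sym Wg). Qed.

Section Signature.
Variables (d : nat) (s : 'I_n -> 'I_n -> 'M[R]_d).

Lemma lap_omega0 (sig : signature W s) (x j : 'I_n) :
  x != j -> lap s (fun y => omega0 W s y j) x = 0.
Proof.
(* An isolated [x] is harmless: its weights vanish, so both sides are [0]. *)
move=> xj; rewrite /lap omega0_step // scaler_sumr -sumrB big1 // => y _.
rewrite scalerA; have [d0|d0] := eqVneq (degw W x) 0.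
  by rewrite d0 mul0r (degw0_weight0 _ d0) subrr.
by rewrite mulrC divfK // subrr.
Qed.

Hypothesis sig : signature W s.

(** Adding the contributions of [(x, y)] and [(y, x)] completes the square, because [s x y] is
    orthogonal with transpose [s y x]. *)
Lemma lap_energy (u : 'I_n -> 'cV[R]_d) :
  (\sum_x (u x)^T *m lap s u x) *+ 2 =
  \sum_x \sum_y W x y *: ((u x - s x y *m u y)^T *m (u x - s x y *m u y)).
Proof.
pose E x y := W x y *: ((u x)^T *m u x - (u x)^T *m (s x y *m u y)).
have -> : \sum_x (u x)^T *m lap s u x = \sum_x \sum_y E x y.
  apply: eq_bigr => x _; rewrite /lap mulmxBr /degw scaler_suml !mulmx_sumr -sumrB.
  by apply: eq_bigr => y _; rewrite /E scalerBr -!scalemxAr.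
have -> : (\sum_x \sum_y E x y) *+ 2 = \sum_x \sum_y (E x y + E y x).
  under [RHS]eq_bigr do rewrite big_split.
  by rewrite big_split /= mulr2n; congr (_ + _); exact: exchange_big.
apply: eq_bigr => x _; apply: eq_bigr => y _.
rewrite /E -(weight_sym Wg x y) -scalerDr.
have [->|w0] := eqVneq (W x y) 0; first by rewrite !scale0r.
have [so ->] : orthogonal_mx (s x y) /\ s y x = (s x y)^T.
  by apply: sig; rewrite /adj lt_neqAle eq_sym w0 weight_ge0.
congr (_ *: _); rewrite [(_ - _)^T]linearB /= mulmxBl !mulmxBr trmx_mul -!mulmxA.
rewrite [(s x y)^T *m (s x y *m _)]mulmxA (mulmx1C so) mul1mx.
by rewrite opprB; congr (_ + _); rewrite addrC.
Qed.

(** Every product [(u x)^T *m lap s u x] vanishes, so the energy is 0 and each of its nonnegative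
    terms is 0. *)
Lemma lap_parallel (u : 'I_n -> 'cV[R]_d) : (forall x, u x = 0 \/ lap s u x = 0) ->
  forall x y, adj W x y -> u x = s x y *m u y.
Proof.
move=> u0 x y xy.
have /(congr1 (fun M : 'M[R]_1 => M 0 0)) := lap_energy u.
rewrite big1 ?mul0rn => [|z _]; last first.
  by have [->|->] := u0 z; rewrite ?trmx0 ?mul0mx ?mulmx0.
have pos z t : 0 <= (W z t *: ((u z - s z t *m u t)^T *m (u z - s z t *m u t))) 0 0.
  rewrite mxE tr_mul_entry mulr_ge0 ?weight_ge0 //.
  by apply: sumr_ge0 => a _; exact: sqr_ge0.
rewrite mxE summxE => /esym/eqP; rewrite psumr_eq0 => [|z _]; last first.
  by rewrite summxE; apply: sumr_ge0 => t _; exact: pos.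
move=> /allP/(_ x); rewrite mem_index_enum summxE => /(_ isT).
rewrite /= psumr_eq0 => [|t _]; last exact: pos.
move=> /allP/(_ y); rewrite mem_index_enum => /(_ isT) /=.
rewrite mxE mulf_eq0 gt_eqF //= => /eqP e0; apply/eqP; rewrite -subr_eq0; apply/eqP.
by apply: tr_mul_eq0; apply/matrixP => a b; rewrite !ord1 e0 mxE.
Qed.

Hypothesis Wc : connected_graph W.

(* The disjunction covers both a function harmonic off [j] and a function supported
   on a set where it is harmonic. *)
Lemma dirichlet_unique m (u : 'I_n -> 'M[R]_(d, m)) j : u j = 0 ->
  (forall x, u x = 0 \/ lap s u x = 0) -> forall x, u x = 0.
Proof.
move=> uj u0 x; apply/matrixP => a b; rewrite [RHS]mxE.
suff /eqP/matrixP/(_ a 0) : col b (u x) == 0 by rewrite !mxE.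
have par y z : adj W y z -> col b (u y) = s y z *m col b (u z).
  apply: (@lap_parallel (fun t => col b (u t))) => {y}z; have [uz|lz] := u0 z; [left|right].
    by rewrite colE uz mul0mx.
  have -> : (fun t => col b (u t)) = (fun t => u t *m delta_mx b 0).
    by apply/funext => t; rewrite colE.
  by rewrite lap_mulmxr lz mul0mx.
(* Parallel transport carries zeros along edges, so by connectedness the zero at [j] reaches [x]. *)
have clo : fingraph.closed (adj W) [pred y | col b (u y) == 0].
  move=> y z yz; rewrite !inE; apply/eqP/eqP => [u_0|u_0].
    by rewrite (par z y) ?u_0 ?mulmx0 // adj_sym.
  by rewrite (par y z) // u_0 mulmx0.
by have := closed_connect clo (Wc x j); rewrite !inE uj [col b 0]colE mul0mx eqxx => ->.
Qed.

End Signature.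
End Laplacian.

(** * Translation between block functions and flat indices *)

Section Flat.
Variables n d : nat.

Lemma unflat_flat (x : 'I_n) (a : 'I_d) : unflat (flat x a) = (x, a).
Proof. by rewrite /unflat /flat /mxvec_index cast_ordK enum_rankK. Qed.

Lemma node_flat (x : 'I_n) (a : 'I_d) : node (flat x a) = x.
Proof. by rewrite /node unflat_flat. Qed.

Lemma comp_flat (x : 'I_n) (a : 'I_d) : Defs.comp (flat x a) = a.
Proof. by rewrite /Defs.comp unflat_flat. Qed.

Lemma sum_flat (M : nmodType) (F : 'I_(n * d) -> M) :
  \sum_p F p = \sum_x \sum_a F (flat x a).
Proof. by rewrite (reindex _ (curry_mxvec_bij _ _)) pair_big; apply: eq_bigr => -[]. Qed.

Definition stack (R : Type) m (h : 'I_n -> 'M[R]_(d, m)) : 'M[R]_(n * d, m) :=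
  \matrix_(p, b) h (node p) (Defs.comp p) b.

Lemma stack_flat (R : Type) m (h : 'I_n -> 'M[R]_(d, m)) x a b : stack h (flat x a) b = h x a b.
Proof. by rewrite mxE node_flat comp_flat. Qed.

Lemma stackK (R : Type) m (U : 'M[R]_(n * d, m)) : stack (fun x => rowsub (flat x) U) = U.
Proof. by apply/matrixP => p b; case/mxvec_indexP: p => x a; rewrite -/(flat x a) stack_flat mxE. Qed.

Lemma rowsub_stack (R : Type) m (h : 'I_n -> 'M[R]_(d, m)) x : rowsub (flat x) (stack h) = h x.
Proof. by apply/matrixP => a b; rewrite mxE stack_flat. Qed.

Lemma mxtrace_stack (R : comNzRingType) m (u v : 'I_n -> 'M[R]_(d, m)) :
  \tr ((stack u)^T *m stack v) = \sum_x \tr ((u x)^T *m v x).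
Proof.
under [RHS]eq_bigr => x _ do rewrite /mxtrace.
rewrite exchange_big; apply: eq_bigr => b _; rewrite mxE sum_flat.
apply: eq_bigr => x _; rewrite mxE; apply: eq_bigr => a _.
by rewrite !mxE node_flat comp_flat.
Qed.

End Flat.

(** * Elimination of the outside nodes and the conductance blocks *)

Section Resistance.
Variables (R : realType) (n : nat) (W : 'M[R]_n).
Hypotheses (Wg : weighted_graph W) (Wc : connected_graph W).

Section Signature.
Variables (d : nat) (s : 'I_n -> 'I_n -> 'M[R]_d).

Lemma conn_lap_flat x y a c :
  conn_lap W s (flat x a) (flat y c) =
  degw W x * ((x == y)%:R * (a == c)%:R) - W x y * s x y a c.
Proof.
rewrite mxE !node_flat !comp_flat; case: eqP => [<-|_].
  by case: Wg => _ _ ->; rewrite mul0r subr0 mul1r.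
by rewrite mul0r mulr0 sub0r mulNr.
Qed.

Lemma conn_lap_stack m (u : 'I_n -> 'M[R]_(d, m)) : conn_lap W s *m stack u = stack (lap W s u).
Proof.
apply/matrixP => p b; case/mxvec_indexP: p => x a.
rewrite -/(flat x a) stack_flat mxE sum_flat /lap !mxE summxE.
under eq_bigr => y _.
  under eq_bigr => c _ do rewrite conn_lap_flat stack_flat mulrBl.
  rewrite sumrB; over.
rewrite sumrB; congr (_ - _).
  rewrite (bigD1 x) //= [X in _ + X]big1 ?addr0 => [|y yx].
    rewrite (bigD1 a) //= big1 ?addr0 => [|c ca]; first by rewrite !eqxx !mulr1.
    by rewrite eq_sym (negbTE ca) !mulr0 mul0r.
  by apply: big1 => c _; rewrite [x == y]eq_sym (negbTE yx) mul0r mulr0 mul0r.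
apply: eq_bigr => y _; rewrite !mxE mulr_sumr; apply: eq_bigr => c _.
by rewrite mulrA.
Qed.

Hypothesis sig : signature W s.

Lemma conn_lap_sym : (conn_lap W s)^T = conn_lap W s.
Proof.
apply/matrixP => p q; case/mxvec_indexP: p => x a; case/mxvec_indexP: q => y c.
rewrite -/(flat x a) -/(flat y c) mxE !conn_lap_flat -(weight_sym Wg x y).
congr (_ - _).
  by rewrite [y == x]eq_sym [c == a]eq_sym; case: (x =P y) => [->|_] //; rewrite !mul0r !mulr0.
have [->|w0] := eqVneq (W x y) 0; first by rewrite !mul0r.
suff /sig[_ ->] : adj W x y by rewrite mxE.
by rewrite /adj lt_neqAle eq_sym w0 weight_ge0.
Qed.

(** The columns at [j] meet the zero block [u j], leaving only those at [i] and outside. *)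
Lemma mulmx_stack_outside q m (M : 'M[R]_(q, n * d)) (u : 'I_n -> 'M[R]_(d, m)) (i j : 'I_n) :
  i != j -> u j = 0 ->
  M *m stack u = colsub (flat i) M *m u i +
    colsub (@enum_val _ (@outside n d i j)) M *m rowsub (@enum_val _ (@outside n d i j)) (stack u).
Proof.
move=> ij uj; apply/matrixP => r b; rewrite !mxE (bigID (@outside n d i j)) /= addrC.
congr (_ + _); last first.
  by rewrite big_enum_val /=; apply: eq_bigr => l _; rewrite !mxE.
transitivity (\sum_(p | node p == i) M r p * stack u p b).
  rewrite big_mkcond [RHS]big_mkcond; apply: eq_bigr => p _.
  rewrite /outside negb_and !negbK; case: (node p =P i) => //= _.
  by case: (node p =P j) => // pj; rewrite mxE pj uj mxE mulr0.
rewrite big_mkcond sum_flat (bigD1 i) //= [X in _ + X]big1 ?addr0 => [|y yi].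
  by apply: eq_bigr => a _; rewrite node_flat eqxx stack_flat mxE.
by apply: big1 => a _; rewrite node_flat (negbTE yi).
Qed.

(** A kernel vector extended by 0 to [i] and [j] is harmonic at all other nodes, so
    [dirichlet_unique] makes it 0. Hence the pseudoinverse in [cond_block] is an inverse. *)
Lemma outside_block_unit (i j : 'I_n) :
  mxsub (@enum_val _ (@outside n d i j)) (@enum_val _ (@outside n d i j)) (conn_lap W s)
    \in unitmx.
Proof.
set ac := enum_val; set L := conn_lap W s.
(* [E] restricts to the outside coordinates and [E^T] extends by 0. *)
pose E : 'M[R]_(_, n * d) := rowsub ac 1%:M.
have EE : E *m E^T = 1%:M.
  apply/matrixP => l l'; rewrite !mxE (bigD1 (ac l)) //= big1 ?addr0 => [|p pl].
    by rewrite !mxE eqxx mul1r (inj_eq enum_val_inj) eq_sym.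
  by rewrite !mxE [_ == p]eq_sym (negbTE pl) mul0r.
have LE : mxsub ac ac L = E *m L *m E^T.
  rewrite /E mul_rowsub_mx mul1mx; apply/matrixP => l l'.
  rewrite !mxE (bigD1 (ac l')) //= big1 ?addr0 => [|p pl].
    by rewrite !mxE eqxx mulr1.
  by rewrite !mxE [_ == p]eq_sym (negbTE pl) mulr0.
rewrite -row_free_unit; apply: inj_row_free => v vL.
pose U := E^T *m v^T; pose u x := rowsub (flat x) U.
have Uout p : ~~ outside i j p -> U p 0 = 0.
  move=> pout; rewrite mxE big1 // => l _; rewrite !mxE.
  have [e|_] := eqVneq (ac l) p; last by rewrite mul0r.
  by case/negP: pout; rewrite -e; exact: (enum_valP l).
have LU p : outside i j p -> (L *m U) p 0 = 0.
  move=> pout.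
  have : E *m (L *m U) = 0.
    rewrite /U !mulmxA -LE; apply: trmx_inj.
    rewrite trmx_mul trmxK trmx0 -[RHS]vL; congr (_ *m _).
    by rewrite trmx_mxsub conn_lap_sym.
  move/matrixP/(_ (enum_rank_in pout p) 0); rewrite mul_rowsub_mx mul1mx !mxE.
  by rewrite /ac enum_rankK_in.
have u0 : forall x, u x = 0.
  apply: (dirichlet_unique Wg sig Wc (j := j)) => [|x].
    by apply/matrixP => a b; rewrite ord1 !mxE -[RHS](Uout (flat j a)) ?mxE // /outside node_flat eqxx andbF.
  have [xout|xout] := boolP ((x != i) && (x != j)); [right|left].
    rewrite -[LHS](rowsub_stack (lap W s u)) -conn_lap_stack stackK.
    by apply/matrixP => a b; rewrite ord1 !mxE -[RHS](LU (flat x a)) ?mxE // /outside node_flat.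
  apply/matrixP => a b; rewrite ord1 !mxE -[RHS](Uout (flat x a)) ?mxE //.
  by rewrite /outside node_flat.
apply: trmx_inj; rewrite trmx0 -[LHS]mul1mx -EE -mulmxA -/U -(stackK U).
by rewrite (_ : stack _ = 0) ?mulmx0 //; apply/matrixP => p b; rewrite mxE -/(u _) u0 !mxE.
Qed.

(** Block Gaussian elimination: the outside rows ([rA]) express [UA] through [u i], and substitution
    into the rows at [i] ([ri]) exhibits [u i] as a right inverse of the Schur complement. *)
Lemma cond_block_inv (u : 'I_n -> 'M[R]_d) (i j : 'I_n) : i != j -> u j = 0 ->
  (forall x, x != j -> lap W s u x = (x == i)%:R%:M) ->
  invmx (cond_block (conn_lap W s) i j i) = u i.
Proof.
move=> ij uj lu; rewrite /cond_block.
set ac := enum_val; set L := conn_lap W s.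
set LA := mxsub ac ac L; set UA := rowsub ac (stack u).
have uLA : LA \in unitmx := outside_block_unit i j.
have rA : mxsub ac (flat i) L *m u i + LA *m UA = 0.
  have -> : mxsub ac (flat i) L = colsub (flat i) (rowsub ac L).
    by apply/matrixP => l a; rewrite !mxE.
  have -> : LA = colsub ac (rowsub ac L) by apply/matrixP => l a; rewrite !mxE.
  rewrite -mulmx_stack_outside // mul_rowsub_mx conn_lap_stack.
  apply/matrixP => l b; rewrite [LHS]mxE [LHS]mxE.
  have /andP[li lj] := enum_valP l.
  by rewrite lu // (negbTE li) mulr0n raddf0 !mxE.
have ri : mxsub (flat i) (flat i) L *m u i + mxsub (flat i) ac L *m UA = 1%:M.
  have -> : mxsub (flat i) (flat i) L = colsub (flat i) (rowsub (flat i) L).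
    by apply/matrixP => l a; rewrite !mxE.
  have -> : mxsub (flat i) ac L = colsub ac (rowsub (flat i) L).
    by apply/matrixP => l a; rewrite !mxE.
  rewrite -mulmx_stack_outside // mul_rowsub_mx conn_lap_stack rowsub_stack.
  by rewrite lu // eqxx.
have UAE : UA = - (invmx LA *m (mxsub ac (flat i) L *m u i)).
  by rewrite -[UA](mulKmx uLA) -mulmxN; congr (_ *m _); apply/eqP; rewrite -addr_eq0 addrC rA.
have CU : (mxsub (flat i) (flat i) L - mxsub (flat i) ac L *m pinv LA *m mxsub ac (flat i) L)
    *m u i = 1%:M.
  by rewrite -ri UAE pinv_unit // mulmxBl mulmxN !mulmxA.
have [uC _] := mulmx1_unit CU.
by rewrite -[LHS]mulmx1 -CU mulKmx.
Qed.

End Signature.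

(** * The scalar graph Laplacian and effective resistance *)

Lemma graph_lap_mul (c : 'cV[R]_n) x :
  (graph_lap W *m c) x 0 = degw W x * c x 0 - \sum_y W x y * c y 0.
Proof.
rewrite mxE; under eq_bigr do rewrite mxE mulrBl.
rewrite sumrB; congr (_ - _); rewrite (bigD1 x) //= eqxx mul1r big1 ?addr0 // => y yx.
by rewrite eq_sym (negbTE yx) !mul0r.
Qed.

Lemma graph_lap_sym : (graph_lap W)^T = graph_lap W.
Proof.
apply/matrixP => x y; rewrite !mxE -(weight_sym Wg x y) eq_sym.
by case: eqP => [->|] //; rewrite !mul0r.
Qed.

Lemma trivial_signature d : signature W (fun _ _ => 1%:M : 'M[R]_d).
Proof. by move=> x y _; rewrite /orthogonal_mx trmx1 mulmx1. Qed.

(** For the trivial 1-dimensional signature, [c] minus its value at [y] is harmonic and vanishes at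
    [y], so [dirichlet_unique] applies. *)
Lemma graph_lap_ker (c : 'cV[R]_n) : graph_lap W *m c = 0 -> forall x y, c x 0 = c y 0.
Proof.
move=> Lc x y; apply/eqP; rewrite -subr_eq0; apply/eqP.
pose u z : 'M[R]_1 := (c z 0 - c y 0)%:M.
suff /matrixP/(_ 0 0) : u x = 0 by rewrite !mxE eqxx mulr1n.
apply: (dirichlet_unique Wg (@trivial_signature 1) Wc (j := y)) => [|z].
  by rewrite /u subrr raddf0.
right; apply/matrixP => a b; rewrite !ord1 /lap !mxE summxE eqxx mulr1n.
under eq_bigr => t _ do rewrite mul1mx !mxE eqxx mulr1n mulrBr.
rewrite sumrB -mulr_suml -/(degw W z) mulrBr.
have := graph_lap_mul c z; rewrite Lc mxE => /esym/eqP; rewrite subr_eq0 => /eqP ->.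
by rewrite subrr.
Qed.

Lemma sum_indicator (i : 'I_n) (F : 'I_n -> R) : \sum_x (x == i)%:R * F x = F i.
Proof.
by rewrite (bigD1 i) //= eqxx mul1r big1 ?addr0 // => x xi; rewrite (negbTE xi) mul0r.
Qed.

(** The vector [e] is orthogonal to the constants, which contain the kernel of the symmetric
    Laplacian, so it lies in the range; [v] is any preimage. *)
Lemma eff_res_potential (i j : 'I_n) : exists v : 'I_n -> R,
  (forall x, degw W x * v x - \sum_y W x y * v y = (x == i)%:R - (x == j)%:R) /\
  eff_res W i j = v i - v j.
Proof.
pose e := evec R i - evec R j.
have : (e^T <= graph_lap W)%MS.
  (* Membership in the row space is tested against the cokernel matrix [K], whose columns are
     constant by [graph_lap_ker]. *)
  rewrite submxE; have := mulmx_coker (graph_lap W).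
  move: (cokermx _) => K LK; apply/eqP/matrixP => a b; rewrite ord1 !mxE.
  have /graph_lap_ker ker : graph_lap W *m col b K = 0.
    by rewrite colE mulmxA LK mul0mx.
  under eq_bigr => x _ do rewrite !mxE mulrBl.
  have E k : \sum_x (x == k)%:R * K x b = K k b.
    exact: sum_indicator.
  rewrite sumrB !E.
  by have := ker i j; rewrite !mxE => ->; rewrite subrr.
case/submxP => D eD.
have Le : graph_lap W *m D^T = e by rewrite -{1}graph_lap_sym -trmx_mul -eD trmxK.
exists (fun x => D^T x 0); split=> [x|].
  by rewrite -graph_lap_mul Le !mxE.
rewrite /eff_res -/e; have [LXL _ _ _] := pinvP (graph_lap W).
rewrite eD -!mulmxA -Le [graph_lap W *m (_ *m _)]mulmxA [_ *m (graph_lap W *m _)]mulmxA LXL Le.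
rewrite !mxE; under eq_bigr => x _ do rewrite !mxE mulrC mulrBl.
have E k : \sum_x (x == k)%:R * D 0 x = D 0 k by exact: sum_indicator.
by rewrite sumrB !E.
Qed.

Lemma eff_resC i j : eff_res W i j = eff_res W j i.
Proof.
by rewrite /eff_res -[evec R j - _]opprB [(- _)^T]linearN /= !mulNmx mulmxN opprK.
Qed.

End Resistance.

(** * Gauge change and splitting into the trivial summand and [tau] *)

Section Decomposition.
Variables (R : realType) (n : nat) (W : 'M[R]_n).
Hypotheses (Wg : weighted_graph W) (Wc : connected_graph W).
Variables (rho k : nat) (tau : 'I_n -> 'I_n -> 'M[R]_k).
Hypotheses (tau_sig : signature W tau) (tau_unit : conn_lap W tau \in unitmx).

Definition blkdiag (A : 'M[R]_rho) (B : 'M[R]_k) : 'M[R]_(rho + k) := block_mx A 0 0 B.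

Lemma lap_blkdiag (a : 'I_n -> 'M[R]_rho) (c : 'I_n -> 'M[R]_k) x :
  lap W (fun x y => blkdiag 1%:M (tau x y)) (fun y => blkdiag (a y) (c y)) x =
  blkdiag (lap W (fun _ _ => 1%:M) a x) (lap W tau c x).
Proof.
rewrite /lap /blkdiag.
have -> : \sum_y W x y *: (block_mx 1%:M 0 0 (tau x y) *m block_mx (a y) 0 0 (c y)) =
    block_mx (\sum_y W x y *: (1%:M *m a y)) 0 0 (\sum_y W x y *: (tau x y *m c y)).
  elim/big_rec3: _ => [|y A B C _ ->]; first by rewrite block_mx0.
  by rewrite mulmx_block !mulmx0 !mul0mx !addr0 !add0r scale_block_mx !scaler0
    add_block_mx !addr0.
by rewrite scale_block_mx !scaler0 opp_block_mx add_block_mx !oppr0 !addr0.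
Qed.

Lemma lap_scalar d (v : 'I_n -> R) x :
  lap W (fun _ _ => 1%:M) (fun y => (v y)%:M : 'M[R]_d) x =
  (degw W x * v x - \sum_y W x y * v y)%:M.
Proof.
rewrite /lap scale_scalar_mx [RHS]raddfB [in RHS]raddf_sum /=; congr (_ - _).
by apply: eq_bigr => y _; rewrite mul1mx scale_scalar_mx.
Qed.

Variables (sigma : 'I_n -> 'I_n -> 'M[R]_(rho + k)) (f : 'I_n -> 'M[R]_(rho + k)).
Hypotheses (sigma_sig : signature W sigma) (f_orth : forall x, orthogonal_mx (f x)).
Hypothesis f_gauge : forall x y, adj W x y ->
  f x *m sigma x y = blkdiag 1%:M (tau x y) *m f y.

Lemma lap_gauge m (u : 'I_n -> 'M[R]_(rho + k, m)) x :
  lap W sigma (fun y => (f y)^T *m u y) x =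
  (f x)^T *m lap W (fun x y => blkdiag 1%:M (tau x y)) u x.
Proof.
rewrite /lap mulmxBr -scalemxAr mulmx_sumr; congr (_ - _).
apply: eq_bigr => y _; rewrite -scalemxAr.
have [->|w0] := eqVneq (W x y) 0; first by rewrite !scale0r.
congr (_ *: _).
have xy : adj W x y by rewrite /adj lt_neqAle eq_sym w0 weight_ge0.
rewrite -[sigma x y]mul1mx -(mulmx1C (f_orth x)) -!mulmxA.
rewrite [f x *m (sigma x y *m _)]mulmxA f_gauge // -!mulmxA.
by rewrite [f y *m _]mulmxA f_orth mul1mx.
Qed.

(** Both sides are 1 at [j] and harmonic off [j], the constant 1 being harmonic on the trivial
    summand; [dirichlet_unique] kills their difference. *)
Lemma omega0_decomp x j :
  omega0 W sigma x j = (f x)^T *m (blkdiag 1%:M (omega0 W tau x j) *m f j).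
Proof.
apply/eqP; rewrite -subr_eq0; apply/eqP; move: x.
apply: (dirichlet_unique Wg sigma_sig Wc (j := j)) => [|x].
  by rewrite !omega0_id // /blkdiag -scalar_mx_block mul1mx (mulmx1C (f_orth j)) subrr.
have [->|xj] := eqVneq x j; [left|right].
  by rewrite !omega0_id // /blkdiag -scalar_mx_block mul1mx (mulmx1C (f_orth j)) subrr.
rewrite lapB lap_omega0 // lap_gauge lap_mulmxr lap_blkdiag lap_omega0 // lap_scalar.
under eq_bigr do rewrite mulr1.
by rewrite mulr1 subrr raddf0 /blkdiag block_mx0 mul0mx mulmx0 subrr.
Qed.

Lemma Nmx_stack d (s : 'I_n -> 'I_n -> 'M[R]_d) i j :
  Nmx W s i j =
  stack (fun x => if x == i then 1%:M else if x == j then - (omega0 W s i j)^T else 0).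
Proof.
by apply/matrixP => p b; rewrite !mxE; case: ifP => _; [|case: ifP => _]; rewrite !mxE.
Qed.

Lemma Wflow_trace (i j : 'I_n) : i != j ->
  \tr ((Wflow W sigma i j)^T *m conn_lap W sigma *m Wflow W sigma i j) =
  rho%:R * eff_res W i j + \tr (invmx (cond_block (conn_lap W tau) i j i)).
Proof.
move=> ij; have ji : j == i = false by rewrite eq_sym (negbTE ij).
have [v [lapv ->]] := eff_res_potential Wg Wc i j.
(* On the [tau] summand the potential is obtained by inverting the Laplacian. *)
pose Vt x : 'M[R]_k := rowsub (flat x) (invmx (conn_lap W tau) *m Nmx W tau i j).
have lapVt x : lap W tau Vt x =
    if x == i then 1%:M else if x == j then - (omega0 W tau i j)^T else 0.
  by rewrite -[LHS]rowsub_stack -conn_lap_stack // stackK mulKVmx // Nmx_stack rowsub_stack.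
have -> : invmx (cond_block (conn_lap W tau) i j i) = Vt i - omega0 W tau i j *m Vt j.
  apply: (cond_block_inv Wg Wc tau_sig (u := fun x => Vt x - omega0 W tau x j *m Vt j)) => //.
    by rewrite omega0_id // mul1mx subrr.
  move=> x xj; rewrite lapB lap_mulmxr lap_omega0 // mul0mx subr0 lapVt (negbTE xj).
  by case: ifP => _; rewrite ?raddf0.
(* The right factor [f i] turns the block of [conn_lap W sigma *m stack V] at [i] into
   [(f i)^T *m f i = 1], and the one at [j] into the transpose of [omega0_decomp], negated. *)
pose V x := (f x)^T *m (blkdiag (v x)%:M (Vt x) *m f i).
have lapV : conn_lap W sigma *m stack V = Nmx W sigma i j.
  rewrite conn_lap_stack // Nmx_stack; congr stack; apply/funext => x.
  rewrite /V lap_gauge lap_mulmxr lap_blkdiag lap_scalar lapv lapVt.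
  have [->|xi] := eqVneq x i.
    by rewrite (negbTE ij) subr0 /blkdiag -scalar_mx_block mul1mx (mulmx1C (f_orth i)).
  have [->|xj] := eqVneq x j.
    rewrite omega0_decomp sub0r /blkdiag !trmx_mul trmxK tr_block_mx !trmx0 trmx1.
    by rewrite -mulmxA -mulmxN -mulNmx opp_block_mx !oppr0 raddfN.
  by rewrite subrr raddf0 /blkdiag block_mx0 mul0mx mulmx0.
rewrite /Wflow (pinv_energy (conn_lap_sym Wg sigma_sig) lapV) Nmx_stack mxtrace_stack.
(* Only the blocks at [i] and [j] of [Nmx] are nonzero; cyclicity of the trace then cancels the
   gauge factors. *)
rewrite (bigD1 i) //= (bigD1 j) 1?eq_sym //= big1 ?addr0 => [|x /andP[xi xj]]; last first.
  by rewrite (negbTE xi) (negbTE xj) mulmx0 mxtrace0.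
rewrite !eqxx ji mulmx1 mulmxN raddfN /= mxtrace_tr -trmx_mul mxtrace_tr omega0_decomp.
rewrite /V -!mulmxA [f j *m _]mulmxA f_orth mul1mx ![\tr ((f i)^T *m _)]mxtrace_mulC.
rewrite -!mulmxA f_orth !mulmx1 mulmx_block !mulmx0 !mul0mx !addr0 add0r mul1mx.
rewrite !mxtrace_block !mxtrace_scalar raddfB /= -!(mulr_natl (v _)).
by ring.
Qed.

End Decomposition.

Theorem theorem6p10 (R : realType) (n d : nat) (W : 'M[R]_n)
  (sigma : 'I_n -> 'I_n -> 'M[R]_d) (rho k : nat)
  (tau : 'I_n -> 'I_n -> 'M[R]_k) (hk : (rho + k)%N = d) :
  weighted_graph W -> connected_graph W ->
  signature W sigma ->
  (1 <= rho <= d)%N ->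
  \rank (kermx (conn_lap W sigma)) = rho ->
  signature W tau ->
  conn_lap W tau \in unitmx ->
  (exists f : 'I_n -> 'M[R]_d, (forall x, orthogonal_mx (f x)) /\
     forall x y, adj W x y ->
       f x *m sigma x y = castmx (hk, hk) (block_mx 1%:M 0 0 (tau x y)) *m f y) ->
  forall i j : 'I_n, i != j ->
  conn_res W sigma i j
  = (rho%:R / d%:R) * eff_res W i j
    + (2 * d)%:R^-1 * \tr (invmx (@cond_block R n k (conn_lap W tau) i j i)
                            + invmx (@cond_block R n k (conn_lap W tau) i j j)).
Proof.
move=> Wg Wc sigma_sig _ _ tau_sig tau_unit [f [f_orth f_gauge]] i j ij.
(* Replacing [d] by [rho + k] makes the cast trivial. *)
case: d / hk sigma sigma_sig f f_orth f_gauge => sigma sigma_sig f f_orth f_gauge.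
have trace := Wflow_trace Wg Wc tau_sig tau_unit sigma_sig f_orth f_gauge.
rewrite /conn_res !mxtraceD !trace // 1?eq_sym // -(eff_resC _ i j).
(* The reversed flow eliminates the same set of nodes. *)
have -> : cond_block (conn_lap W tau) j i j = cond_block (conn_lap W tau) i j j.
  rewrite /cond_block; have -> // : @outside n k j i = @outside n k i j.
  by apply/funext => p; rewrite /outside andbC.
rewrite natrM invfM; set D := (rho + k)%:R^-1; set t1 := \tr _; set t2 := \tr _.
by field.
Qed.
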